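(* Let $n$ be a positive integer and let $w\in \mathrm{T}\mathbb{S}_n^{\circ}=\mathrm{Trop}(\mathbb{S}_n^{\circ})$. Then there is a closed immersion of $\mathbf{k}$-schemes $$\mathrm{in}_w\mathbb{S}_n^{\circ}\hookrightarrow \varprojlim_{Q\in\Delta_w}\mathbb{S}_{M_Q}.$$
   Context: $\mathbf{k}$ is an algebraically closed field of characteristic $0$ (trivially valued), $[n]=\{0,1,\dots,n-1\}$, and $E(n)$ is the set of subsets $\lambda\subset[n]$ with $n-|\lambda|$ even. Spinor variety: $\mathbb{S}_n\subset\mathbb{P}(\mathbf{k}^{E(n)})$ is the Zariski closure of the set of points $[\mathrm{Pf}(X[[n]\setminus\lambda])]_{\lambda\in E(n)}$, where $X$ runs over skew-symmetric $n\times n$ matrices over $\mathbf{k}$ with rows and columns indexed by $[n]$, $X[\mu]$ is the principal submatrix on $\mu$, and $\mathrm{Pf}$ is the Pfaffian ($\mathrm{Pf}$ of the empty matrix is $1$). The matrix $X$ corresponds to the totally isotropic subspace spanned by the rows of $[I\,|\,X]$. Let $I_n\subset\mathbf{k}[q_\lambda:\lambda\in E(n)]$ be the homogeneous ideal of $\mathbb{S}_n$, and $\mathbb{S}_n^{\circ}$ the intersection of $\mathbb{S}_n$ with the dense torus $T$ (all $q_\lambda\neq0$) of $\mathbb{P}(\mathbf{k}^{E(n)})$. Tropicalization and initial degenerations: for $w\in\mathbb{R}^{E(n)}/\mathbb{R}(1,\dots,1)$ and $f=\sum c_aq^a$, $\mathrm{in}_wf$ is the sum of the terms $c_aq^a$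 with $c_a\ne 0$ and $\langle w,a\rangle$ minimal; $\mathrm{in}_wI_n$ is the ideal generated by all $\mathrm{in}_wf$, $f\in I_n$. $\mathrm{Trop}(\mathbb{S}_n^{\circ})$ is the set of $w$ such that $\mathrm{in}_wI_n$ does not generate the unit ideal in the Laurent polynomial ring, and $\mathrm{in}_w\mathbb{S}_n^{\circ}=T\cap\mathrm{Proj}(\mathbf{k}[q_\lambda]/\mathrm{in}_wI_n)$. $\Delta$-matroids: an even $\Delta$-matroid $M$ on $[n]$ is given by a nonempty collection $\mathcal{B}(M)$ (bases) of subsets of $[n]$ such that for all $\mu,\nu\in\mathcal{B}(M)$ and $i\in\mu\Delta\nu$ there is $j\in\mu\Delta\nu$ with $\mu\Delta\{i,j\}\in\mathcal{B}(M)$, and $|\mu\Delta\nu|$ is even for all $\mu,\nu\in\mathcal{B}(M)$. Its polytope is $Q_M=\mathrm{conv}\{e_\lambda:\lambda\in\mathcal{B}(M)\}\subset\mathbb{R}^n$, $e_\lambda=\sum_{i\in\lambda}e_i$. Any face of $Q_M$ is again the polytope of an even $\Delta$-matroid; $M_Q$ denotes the even $\Delta$-matroid with polytope $Q$. Strata: for an even $\Delta$-matroid $M$ with $\mathcal{B}(M)\subset E(n)$, let $B_M=\mathbf{k}[q_\lambda:\lambda\in\mathcal{B}(M)]$, $I_M=(\langle q_\lambda:\lambda\in E(n)\setminus\mathcal{B}(M)\rangle+I_n)\cap B_M$, and $\mathbb{S}_M=T_M\cap\mathrm{Proj}(B_M/I_M)$, where $T_M$ is the dense torus of $\mathrm{Proj}(B_M)$.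 If $Q'$ is a face of $Q$, the inclusion $B_{M_{Q'}}\subset B_{M_Q}$ induces a morphism $\mathbb{S}_{M_Q}\to\mathbb{S}_{M_{Q'}}$. Subdivision: $\Delta(n)=\mathrm{conv}\{e_\lambda:\lambda\in E(n)\}$. $\Delta_w$ is the regular subdivision of $\Delta(n)$ induced by $w$, i.e. the polyhedral complex of projections of lower faces of $\mathrm{conv}\{(e_\lambda,w_\lambda):\lambda\in E(n)\}$. For $w\in\mathrm{Trop}(\mathbb{S}_n^\circ)$ every cell of $\Delta_w$ is an even $\Delta$-matroid polytope. The inverse limit is taken in $\mathbf{k}$-schemes over the diagram of all $\mathbb{S}_{M_Q}$, $Q\in\Delta_w$, with the morphisms $\mathbb{S}_{M_Q}\to\mathbb{S}_{M_{Q'}}$ induced by the inclusions $B_{M_{Q'}}\subset B_{M_Q}$ for faces $Q'\subset Q$. *)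

(* Defs.v *)
From HB Require Import structures.
From mathcomp Require Import all_boot all_order all_fingroup all_algebra.
From mathcomp Require Import fraction.
From mathcomp Require Import boolp classical_sets reals.
From mathcomp Require Import mpoly.

Set Implicit Arguments.
Unset Strict Implicit.
Unset Printing Implicit Defensive.

Import Order.TTheory GRing.Theory Num.Theory.

Local Open Scope classical_set_scope.
Local Open Scope ring_scope.

(* Schemes over k are represented by their functors of points               *)
(* (commutative k-algebras) -> Set, as in Demazure-Gabriel.  The functor    *)
(* of points is fully faithful, so a morphism of k-schemes is a natural     *)
(* transformation, and limits of k-schemes are computed pointwise.  A       *)
(* comAlgType is a nonzero ring; nothing is lost, since every scheme has    *)
(* exactly one point with values in the zero ring.                          *)

Record kfunctor (k : fieldType) := KFunctor {
  points :> comAlgType k -> Type;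
  pmap : forall A B : comAlgType k, {lrmorphism A -> B} -> points A -> points B;
  pmap_id : forall (A : comAlgType k) (f : {lrmorphism A -> A}),
    f =1 id -> pmap f =1 id;
  pmap_comp : forall (A B C : comAlgType k) (f : {lrmorphism A -> B})
      (g : {lrmorphism B -> C}) (h : {lrmorphism A -> C}),
    h =1 g \o f -> pmap h =1 pmap g \o pmap f }.

Record kmorphism (k : fieldType) (X Y : kfunctor k) := KMorphism {
  mor_at :> forall A : comAlgType k, X A -> Y A;
  mor_nat : forall (A B : comAlgType k) (f : {lrmorphism A -> B}) (x : X A),
    mor_at (pmap f x) = pmap f (mor_at x) }.

Record is_ideal (A : comNzRingType) (J : set A) : Prop := IsIdeal {
  ideal0 : J 0;
  idealD : forall a b, J a -> J b -> J (a + b);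
  idealM : forall a b, J b -> J (a * b) }.

Definition ideal_gen (A : comNzRingType) (S : set A) : set A :=
  smallest (@is_ideal A) S.

(* A monomorphism whose base change along any A-point y of Y, that is, along *)
(* any morphism Spec A -> Y, is the closed subscheme V(J) of Spec A for an   *)
(* ideal J of A (Demazure-Gabriel I.2; Jantzen, Representations of algebraic *)
(* groups, I.1.12).                                                          *)
Definition closed_immersion (k : fieldType) (X Y : kfunctor k)
    (f : kmorphism X Y) : Prop :=
  (forall A : comAlgType k, injective (f A)) /\
  forall (A : comAlgType k) (y : Y A), exists2 J : set A, is_ideal J &
    forall (B : comAlgType k) (phi : {lrmorphism A -> B}),
      (exists x : X B, f B x = pmap phi y) <-> (forall a, J a -> phi a = 0).

(* Points of the dense torus of P(k^I): its A-points are the unit families   *)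
(* I -> A modulo multiplication by a common unit of A.                      *)
(* A class is stored as the set of all its representatives.                 *)

Definition is_unit (A : comNzRingType) (a : A) : Prop := exists b, a * b = 1.

Definition unit_class (I : finType) (A : comNzRingType) (x : I -> A) :
    set (I -> A) :=
  [set y | exists2 u, is_unit u & y = fun i => u * x i].

Record torus_pt (I : finType) (A : comNzRingType) := TorusPt {
  coords :> set (I -> A);
  coordsP : exists2 x, (forall i, is_unit (x i)) & coords = unit_class x }.

Lemma torus_pt_eq (I : finType) (A : comNzRingType) (p q : torus_pt I A) :
  coords p = coords q -> p = q.
Proof.
by case: p q => [C hC] [D hD] /= e; subst D; congr TorusPt; exact: Prop_irrelevance.
Qed.

Lemma sval_eq (T : Type) (P : T -> Prop) (x y : {a : T | P a}) :
  sval x = sval y -> x = y.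
Proof. by case: x y => [a pa] [b pb] /= e; subst b; congr exist; exact: Prop_irrelevance. Qed.

Lemma is_unit1 (A : comNzRingType) : is_unit (1 : A).
Proof. by exists 1; rewrite mulr1. Qed.

Lemma is_unitM (A : comNzRingType) (a b : A) :
  is_unit a -> is_unit b -> is_unit (a * b).
Proof. by move=> [c ac] [d bd]; exists (c * d); rewrite mulrACA ac bd mulr1. Qed.

Lemma is_unit_rmorph (A B : comNzRingType) (f : {rmorphism A -> B}) (a : A) :
  is_unit a -> is_unit (f a).
Proof. by move=> [b ab]; exists (f b); rewrite -rmorphM ab rmorph1. Qed.

Lemma unit_class_id (I : finType) (A : comNzRingType) (x : I -> A) :
  unit_class x x.
Proof. by exists 1; [exact: is_unit1 | apply/funext => i; rewrite mul1r]. Qed.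

Lemma unit_class_pushE (I : finType) (A B : comNzRingType)
    (f : {rmorphism A -> B}) (x : I -> A) :
  \bigcup_(y in unit_class x) unit_class (f \o y) = unit_class (f \o x).
Proof.
apply/seteqP; split=> z /=.
  move=> [_ [u uu ->]] [v vv ->]; exists (v * f u).
    exact: is_unitM vv (is_unit_rmorph _ uu).
  by apply/funext => i /=; rewrite rmorphM mulrA.
by move=> h; exists x => //; exact: unit_class_id.
Qed.

Lemma torus_push_proof (I : finType) (A B : comNzRingType)
    (f : {rmorphism A -> B}) (p : torus_pt I A) :
  exists2 x, (forall i, is_unit (x i)) &
    \bigcup_(y in coords p) unit_class (f \o y) = unit_class x.
Proof.
have [x ux ->] := coordsP p; exists (f \o x); last exact: unit_class_pushE.
by move=> i; exact: is_unit_rmorph.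
Qed.

Definition torus_push (I : finType) (A B : comNzRingType)
    (f : {rmorphism A -> B}) (p : torus_pt I A) : torus_pt I B :=
  TorusPt (torus_push_proof f p).

Lemma torus_restr_proof (I J : finType) (A : comNzRingType) (g : J -> I)
    (p : torus_pt I A) :
  exists2 x, (forall i, is_unit (x i)) &
    [set y \o g | y in coords p] = unit_class x.
Proof.
have [x ux ->] := coordsP p; exists (x \o g); first by move=> i; exact: ux.
apply/seteqP; split=> z /=.
  by move=> [_ [u uu ->] <-]; exists u.
by move=> [u uu ->]; exists (fun i => u * x i) => //; exists u.
Qed.

(* The morphism of tori dual to the inclusion q_j |-> q_(g j) of variables.  *)
Definition torus_restr (I J : finType) (A : comNzRingType) (g : J -> I)
    (p : torus_pt I A) : torus_pt J A :=
  TorusPt (torus_restr_proof g p).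

Lemma torus_push_id (I : finType) (A : comNzRingType) (f : {rmorphism A -> A})
    (p : torus_pt I A) : f =1 id -> torus_push f p = p.
Proof.
move=> fid; apply: torus_pt_eq => /=; have [x _ ->] := coordsP p.
by rewrite unit_class_pushE; congr unit_class; apply/funext => i /=; rewrite fid.
Qed.

Lemma torus_push_comp (I : finType) (A B C : comNzRingType)
    (f : {rmorphism A -> B}) (g : {rmorphism B -> C}) (h : {rmorphism A -> C})
    (p : torus_pt I A) :
  h =1 g \o f -> torus_push h p = torus_push g (torus_push f p).
Proof.
move=> hgf; apply: torus_pt_eq => /=; have [x _ ->] := coordsP p.
rewrite !unit_class_pushE; congr unit_class.
by apply/funext => i /=; rewrite hgf.
Qed.

Lemma torus_restr_push (I J : finType) (A B : comNzRingType) (g : J -> I)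
    (f : {rmorphism A -> B}) (p : torus_pt I A) :
  torus_restr g (torus_push f p) = torus_push f (torus_restr g p).
Proof.
have eR D (q : torus_pt I D) x :
    coords q = unit_class x -> coords (torus_restr g q) = unit_class (x \o g).
  move=> /= ->; apply/seteqP; split=> z /=.
    by move=> [_ [u uu ->] <-]; exists u.
  by move=> [u uu ->]; exists (fun i => u * x i) => //; exists u.
apply: torus_pt_eq; have [x _ px] := coordsP p.
rewrite (eR _ _ (f \o x)) /=; last by rewrite px unit_class_pushE.
by have /= -> := eR _ _ _ px; rewrite unit_class_pushE.
Qed.

(* {mpoly k[#|I|]} is used as the polynomial ring k[q_i : i in I]: the       *)
(* variable q_i is the one numbered enum_rank i.                             *)

Section Polynomials.
Variables (k : fieldType) (I : finType).

Definition qvar (i : I) : {mpoly k[#|I|]} := 'X_(enum_rank i).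

Definition peval (A : comAlgType k) (x : I -> A) (f : {mpoly k[#|I|]}) : A :=
  mmap (GRing.in_alg A) (fun j => x (enum_val j)) f.

Lemma peval_push (A B : comAlgType k) (phi : {lrmorphism A -> B})
    (x : I -> A) (f : {mpoly k[#|I|]}) :
  peval (phi \o x) f = phi (peval x f).
Proof.
rewrite /peval /mmap rmorph_sum /=; apply: eq_bigr => m _.
rewrite rmorphM /= !linearZ !rmorph1 /mmap1 rmorph_prod; congr (_ * _).
by apply: eq_bigr => i _; rewrite rmorphXn.
Qed.

(* For a homogeneous ideal J, the functor of points of the affine scheme     *)
(* T \cap Proj(k[q]/J), where T is the dense torus of P(k^I); the vanishing  *)
(* of J does not depend on the representative x because J is homogeneous.    *)
Definition torus_proj_points (J : set {mpoly k[#|I|]}) (A : comAlgType k) :=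
  {p : torus_pt I A |
     exists2 x, coords p x & forall f, J f -> peval x f = 0}.

Lemma torus_proj_map_proof (J : set {mpoly k[#|I|]}) (A B : comAlgType k)
    (phi : {lrmorphism A -> B}) (p : torus_proj_points J A) :
  exists2 x, coords (torus_push phi (sval p)) x &
    forall f, J f -> peval x f = 0.
Proof.
have [x px Jx] := svalP p; exists (phi \o x) => [|f Jf].
  by exists x => //; exact: unit_class_id.
by rewrite peval_push Jx // rmorph0.
Qed.

Definition torus_proj_map (J : set {mpoly k[#|I|]}) (A B : comAlgType k)
    (phi : {lrmorphism A -> B}) (p : torus_proj_points J A) :
    torus_proj_points J B :=
  exist _ (torus_push phi (sval p)) (torus_proj_map_proof phi p).

Lemma torus_proj_map_id (J : set {mpoly k[#|I|]}) (A : comAlgType k)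
    (f : {lrmorphism A -> A}) :
  f =1 id -> @torus_proj_map J A A f =1 id.
Proof. by move=> fid p; apply: sval_eq; exact: torus_push_id. Qed.

Lemma torus_proj_map_comp (J : set {mpoly k[#|I|]}) (A B C : comAlgType k)
    (f : {lrmorphism A -> B}) (g : {lrmorphism B -> C})
    (h : {lrmorphism A -> C}) :
  h =1 g \o f ->
  @torus_proj_map J A C h =1 @torus_proj_map J B C g \o @torus_proj_map J A B f.
Proof. by move=> hgf p; apply: sval_eq; exact: torus_push_comp. Qed.

Definition torus_proj (J : set {mpoly k[#|I|]}) : kfunctor k :=
  KFunctor (@torus_proj_map_id J) (@torus_proj_map_comp J).

Definition wdeg (R : realType) (w : I -> R) (m : 'X_{1..#|I|}) : R :=
  \sum_(i : I) w i *+ m (enum_rank i).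

Definition init_form (R : realType) (w : I -> R) (f : {mpoly k[#|I|]}) :
    {mpoly k[#|I|]} :=
  \sum_(m <- msupp f | all (fun m' => wdeg w m <= wdeg w m') (msupp f))
    f@_m *: 'X_[m].

Definition init_ideal (R : realType) (w : I -> R) (J : set {mpoly k[#|I|]}) :
    set {mpoly k[#|I|]} :=
  ideal_gen (init_form w @` J).

(* The Laurent polynomial ring k[q_i^{+-1}], inside the field k(q).          *)
Definition laurent : set {fraction {mpoly k[#|I|]}} :=
  [set l | exists (m : 'X_{1..#|I|}) (f : {mpoly k[#|I|]}),
     l * tofrac 'X_[m] = tofrac f].

Definition laurent_unit_ideal (J : set {mpoly k[#|I|]}) : Prop :=
  exists s : seq ({fraction {mpoly k[#|I|]}} * {mpoly k[#|I|]}),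
    (forall p, p \in s -> laurent p.1 /\ J p.2) /\
    \sum_(p <- s) p.1 * tofrac p.2 = 1.

(* Subsets of P(k^I) are given by their affine cones without the origin.     *)
Definition zariski_closure (Z : set (I -> k)) : set (I -> k) :=
  [set y | (exists i, y i != 0) /\
     forall (d : nat) (f : {mpoly k[#|I|]}), f \is d.-homog ->
       (forall z, Z z -> f.@[fun j => z (enum_val j)] = 0) ->
       f.@[fun j => y (enum_val j)] = 0].

Definition homog_ideal (Y : set (I -> k)) : set {mpoly k[#|I|]} :=
  ideal_gen [set f | (exists d : nat, f \is d.-homog) /\
                     forall y, Y y -> f.@[fun j => y (enum_val j)] = 0].

End Polynomials.


Definition evenset (n : nat) := {l : {set 'I_n} | ~~ odd (n - #|l|)}.

(* Sum over all permutations; each perfect matching is counted               *)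
(* 2 ^ (m / 2) * (m / 2)! times.  For even i and even m, ordS i is i + 1.    *)
Definition pfaffian (k : fieldType) (m : nat) (A : 'M[k]_m) : k :=
  if odd m then 0 else
  ((2 ^ m./2 * (m./2)`!)%N%:R)^-1 *
    \sum_(s : 'S_m) (-1) ^+ s *
      \prod_(i < m | ~~ odd i) A (s i) (s (ordS i)).

Definition principal_submx (k : fieldType) (n : nat) (X : 'M[k]_n)
    (mu : {set 'I_n}) : 'M[k]_#|mu| :=
  mxsub (@enum_val _ (mem mu)) (@enum_val _ (mem mu)) X.

Definition pfaffian_pt (k : fieldType) (n : nat) (X : 'M[k]_n) :
    evenset n -> k :=
  fun l => pfaffian (principal_submx X (~: val l)%SET).

Definition spinor_variety (k : fieldType) (n : nat) : set (evenset n -> k) :=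
  zariski_closure [set pfaffian_pt X | X in [set X : 'M[k]_n | X^T = - X]].

Definition spinor_ideal (k : fieldType) (n : nat) :
    set {mpoly k[#|{: evenset n}|]} :=
  homog_ideal (@spinor_variety k n).

(* A weight modulo R(1,...,1) is given by any representative w: the initial  *)
(* ideal of a homogeneous ideal does not depend on the choice.               *)
Definition trop_spinor (k : fieldType) (R : realType) (n : nat) :
    set (evenset n -> R) :=
  [set w | ~ laurent_unit_ideal (init_ideal w (@spinor_ideal k n))].

Definition init_degen (k : fieldType) (R : realType) (n : nat)
    (w : evenset n -> R) : kfunctor k :=
  torus_proj (init_ideal w (@spinor_ideal k n)).

(* An even Delta-matroid M enters its stratum S_M = T_M \cap Proj(B_M / I_M) *)
(* only through its set B of bases; B_M is the polynomial ring in the        *)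
(* variables q_l for l in B, and basis_incl its inclusion into the           *)
(* polynomial ring in all variables.                                         *)

Definition basis_var (n : nat) (B : {set evenset n}) :=
  {l : evenset n | l \in B}.

Definition basis_incl (k : fieldType) (n : nat) (B : {set evenset n})
    (f : {mpoly k[#|{: basis_var B}|]}) : {mpoly k[#|{: evenset n}|]} :=
  f \mPo [tuple qvar k (val (enum_val j)) | j < #|{: basis_var B}|].

Definition stratum_ideal (k : fieldType) (n : nat) (B : {set evenset n}) :
    set {mpoly k[#|{: basis_var B}|]} :=
  [set f | [set g + h | g in ideal_gen [set qvar k l | l in [set l | l \notin B]]
                      & h in @spinor_ideal k n] (basis_incl f)].

Definition stratum (k : fieldType) (n : nat) (B : {set evenset n}) :
    kfunctor k :=
  torus_proj (@stratum_ideal k n B).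

Definition basis_var_incl (n : nat) (B B' : {set evenset n})
    (sB'B : B' \subset B) (l : basis_var B') : basis_var B :=
  exist _ (val l) (fintype.subsetP sB'B _ (valP l)).


Section Polytopes.
Variables (R : realType).

Definition conv (I : finType) (V : lmodType R) (v : I -> V) : set V :=
  [set p | exists c : I -> R,
     [/\ forall i, 0 <= c i, \sum_i c i = 1 & p = \sum_i c i *: v i]].

Definition face_of (V : lmodType R) (u : {scalar V}) (P : set V) : set V :=
  [set p | P p /\ forall q, P q -> u p <= u q].

Definition is_face (V : lmodType R) (P' P : set V) : Prop :=
  exists u : {scalar V}, P' = face_of u P.

Variable n : nat.

Definition evec (l : {set 'I_n}) : 'rV[R]_n := \row_i (i \in l)%:R.

Definition lift_polytope (w : evenset n -> R) : set ('rV[R]_n * R^o) :=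
  conv (fun l : evenset n => (evec (val l), w l) : 'rV[R]_n * R^o).

(* The cells are the projections of the lower faces, that is, of the faces   *)
(* minimizing a linear functional u that is positive on the last coordinate. *)
Definition reg_subdiv (w : evenset n -> R) : set (set 'rV[R]_n) :=
  [set Q | exists2 u : {scalar ('rV[R]_n * R^o)%type}, 0 < u (0, 1) &
     Q = fst @` face_of u (lift_polytope w)].

(* The bases of the even Delta-matroid M_Q with polytope Q: by bases_of_conv, *)
(* a set B of bases is recovered from its polytope Q as bases_of Q.           *)
Definition bases_of (Q : set 'rV[R]_n) : {set evenset n} :=
  [set l | `[< Q (evec (val l)) >]]%SET.

Lemma bases_of_conv (B : {set evenset n}) :
  bases_of (conv (fun l : basis_var B => evec (val (val l)))) = B.
Proof.
apply/setP => l; rewrite inE; apply/asboolP/idP => [[c [c0 c1 el]]|lB]; last first.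
  pose l0 : basis_var B := exist _ l lB.
  exists (fun m => (m == l0)%:R); split.
  - by move=> m; exact: ler0n.
  - rewrite (bigD1 l0) //= eqxx big1 ?addr0 // => m /negbTE ->; done.
  - rewrite (bigD1 l0) //= eqxx scale1r big1 ?addr0 // => m /negbTE ->.
    by rewrite scale0r.
have [m cm] : exists m, c m != 0.
  apply: contrapT => /forallNP h; have : \sum_m c m = 0.
    by apply: big1 => m _; have /negP := h m; rewrite negbK => /eqP.
  by move/eqP; rewrite c1 oner_eq0.
suff -> : l = val m by exact: valP.
apply/val_inj/setP => i.
have ci : (i \in val l)%:R = \sum_m c m * (i \in val (val m))%:R :> R.
  have := congr1 (fun v : 'rV[R]_n => v 0 i) el; rewrite mxE summxE => ->.
  by apply: eq_bigr => j _; rewrite !mxE.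
have [il|il] := boolP (i \in val l).
  apply/esym; apply: contraT => im; move: ci; rewrite il -[LHS]c1 => /eqP.
  rewrite -subr_eq0 -sumrB psumr_eq0; last first.
    by move=> j _; rewrite subr_ge0; case: (i \in val (val j)); rewrite ?mulr1 ?mulr0 ?c0.
  move=> /allP /(_ m (mem_index_enum _)) /=.
  by rewrite (negbTE im) mulr0 subr0 (negbTE cm).
apply/esym/negbTE/negP => im; move: ci; rewrite (negbTE il) => /esym/eqP.
rewrite psumr_eq0; last by move=> j _; rewrite mulr_ge0 ?c0 ?ler0n.
by move=> /allP /(_ m (mem_index_enum _)) /=; rewrite im mulr1 (negbTE cm).
Qed.

Lemma bases_of_face (Q' Q : set 'rV[R]_n) :
  is_face Q' Q -> bases_of Q' \subset bases_of Q.
Proof.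
move=> [u ->]; apply/fintype.subsetP => l; rewrite !inE => h.
by case: h.
Qed.

End Polytopes.

(* Points of the inverse limit are compatible families of points of the      *)
(* strata S_(M_Q).  For a face Q' of Q, the morphism S_(M_Q) -> S_(M_Q') is   *)
(* the restriction of coordinates to the bases of M_Q'; the compatibility is  *)
(* an equality in the torus, of which the stratum S_(M_Q') is a subfunctor.   *)

Section Limit.
Variables (k : fieldType) (R : realType) (n : nat) (w : evenset n -> R).

Definition cell := {Q : set 'rV[R]_n | reg_subdiv w Q}.

Definition lim_points (A : comAlgType k) :=
  {x : forall Q : cell, stratum k (bases_of (sval Q)) A |
     forall (Q Q' : cell) (h : is_face (sval Q') (sval Q)),
       torus_restr (basis_var_incl (bases_of_face h)) (sval (x Q))
       = sval (x Q')}.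

Lemma lim_map_proof (A B : comAlgType k) (phi : {lrmorphism A -> B})
    (x : lim_points A) (Q Q' : cell) (h : is_face (sval Q') (sval Q)) :
  torus_restr (basis_var_incl (bases_of_face h)) (sval (pmap phi (sval x Q)))
  = sval (pmap phi (sval x Q')).
Proof. by rewrite /= torus_restr_push (svalP x). Qed.

Definition lim_map (A B : comAlgType k) (phi : {lrmorphism A -> B})
    (x : lim_points A) : lim_points B :=
  exist _ (fun Q => pmap phi (sval x Q)) (lim_map_proof phi x).

Lemma lim_map_id (A : comAlgType k) (f : {lrmorphism A -> A}) :
  f =1 id -> lim_map f =1 id.
Proof.
by move=> fid x; apply: sval_eq; apply: functional_extensionality_dep => Q /=; exact: (torus_proj_map_id fid).
Qed.

Lemma lim_map_comp (A B C : comAlgType k) (f : {lrmorphism A -> B})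
    (g : {lrmorphism B -> C}) (h : {lrmorphism A -> C}) :
  h =1 g \o f -> lim_map h =1 lim_map g \o lim_map f.
Proof.
move=> hgf x; apply: sval_eq; apply: functional_extensionality_dep => Q /=.
exact: (torus_proj_map_comp hgf).
Qed.

Definition lim_strata : kfunctor k := KFunctor lim_map_id lim_map_comp.

End Limit.

(* Main.v *)
(* Scaling rows and columns of X shows that the ideal I_n is homogeneous for *)
(* the Z^n-grading by the weights e_l.  If u is the functional cutting out a *)
(* cell Q, then within one multidegree w and u give the same initial forms   *)
(* up to a shift, and the monomials of least u-weight are those supported on *)
(* the bases of M_Q.  Hence every f in I_{M_Q} lies in in_w I_n, and         *)
(* restricting coordinates to the bases maps in_w S_n into S_{M_Q}.          *)
(* Any two vertices of Delta(n) are joined by a chain of cells (move the     *)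
(* functional linearly from one vertex to the other), so a point of the      *)
(* torus is determined by its image in the limit: a compatible family y      *)
(* dictates, along chosen chains, a single candidate x.  The base change     *)
(* along y is then the locus where x restricts to y on every cell and        *)
(* satisfies in_w I_n, which is closed; acyclicity of the subdivision is not *)
(* needed.                                                                   *)

Require Import Defs.
From HB Require Import structures.
From mathcomp Require Import all_boot all_order perm all_algebra.
From mathcomp Require Import boolp classical_sets reals.
From mathcomp Require Import mpoly lra.

Set Implicit Arguments.
Unset Strict Implicit.
Unset Printing Implicit Defensive.

Import Order.TTheory GRing.Theory Num.Theory.
Local Open Scope ring_scope.

(** The morphism restricts the coordinates of a point to the bases of each cell. It lands in the
    strata because [I_n] is multigraded: scaling row and column [i] of [X] rescales the Pfaffians
    ([spinor_cone_scale]), so the components of a member of [I_n] lie in [I_n]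
    ([spinor_ideal_component]). Let [u] cut out the cell [Q]. Within one multidegree the weights by
    [u] and by [w] agree up to a positive factor and a constant ([lifted_weight]), so if a component
    has monomials supported on the bases of [Q], these make up its initial form ([supported_wmin]).
    Setting the other variables to 0 thus turns a member of [I_n] into a sum of initial forms, and
    the equations of the stratum hold ([stratum_ideal_vanish]).

    In the other direction, cells link any two vertices ([cells_connected]) and each cell fixes the
    ratios of its coordinates, so a compatible family leaves a single candidate [x]
    ([over_determined]). This gives injectivity. The candidate is a preimage when the initial ideal
    vanishes at [x] and [x] is proportional to the family on every cell, which are closed conditions
    ([init_degen_immersion_closed]). *)

(** * Lower envelopes of affine functions *)

(* Follows the lower envelope of the affine functions [t |-> a i + t * b i]  *)
(* from time 0 to time 1; every breakpoint strictly decreases the slope.     *)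
Lemma lower_envelope_ind (R : realFieldType) (I : finType) (a b : I -> R)
    (P : I -> Prop) :
  (forall t i j, (forall l, a i + t * b i <= a l + t * b l) ->
     (forall l, a j + t * b j <= a l + t * b l) -> P i -> P j) ->
  forall i j, (forall l, a i <= a l) -> (forall l, a j + b j <= a l + b l) ->
  P i -> P j.
Proof.
move=> step i j imin jmin.
have {imin} : forall l, a i + 0 * b i <= a l + 0 * b l.
  by move=> l; rewrite !mul0r !addr0.
have : (0 : R) <= 1 by exact: ler01.
move: (0 : R) => t.
have [N] := ubnP #|[set l | b l < b i]|.
elim: N i t => // N IHN i t; rewrite ltnS => leN t1 imin Pi.
(* The time at which a function [l] of smaller slope meets the function [i]. *)
pose tau l := (a l - a i) / (b i - b l).
have tauE l : b l < b i -> tau l * (b i - b l) = a l - a i.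
  by move=> bl; rewrite /tau divfK // subr_eq0 gt_eqF.
have [/existsP [l0 /andP [bl0 tl0]]|/existsPn none] :=
    boolP [exists l, (b l < b i) && (tau l < 1)]; last first.
  (* Nothing overtakes [i] before time 1, so [i] and [j] are both minimal at time 1. *)
  apply: (step 1 i) Pi => l; rewrite !mul1r //.
  have := imin l; have := none l; rewrite negb_and -!leNgt.
  have [bl /=|bl _] := ltP (b l) (b i); last by nra.
  by have := tauE l bl; nra.
(* At the first crossing [i] and [l] are both minimal; the walk goes on along [l]. *)
case: (@Order.TotalTheory.arg_minP _ _ _ l0 (fun l => b l < b i) tau bl0).
move=> l bl lmin.
have tl : tau l < 1 by apply: le_lt_trans (lmin _ bl0) tl0.
have El := tauE l bl.
have ttl : t <= tau l by have := imin l; nra.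
have imin' m : a i + tau l * b i <= a m + tau l * b m.
  have := imin m; have [bm _|bm] := ltP (b m) (b i); last by nra.
  by have := lmin m bm; have := tauE m bm; nra.
have lmin' m : a l + tau l * b l <= a m + tau l * b m.
  by apply: le_trans (imin' m); nra.
apply: (IHN l (tau l)) => //; [|exact: ltW|exact: (step (tau l) i)].
apply: leq_trans leN; apply: proper_card; apply/properP; split.
  by apply/fintype.subsetP => m; rewrite !inE => /lt_trans; apply.
by exists l; rewrite !inE ?ltxx.
Qed.

(** * Cells of the regular subdivision *)

Section Cells.
Variables (R : realType) (n : nat) (w : evenset n -> R).

Definition lifted (l : evenset n) : 'rV[R]_n * R^o := (evec R (val l), w l).

(** A functional normalised to take the value 1 on the last basis vector, so that its minimal face
    is a lower face. *)
Definition heightsum (a : 'I_n -> R) (p : 'rV[R]_n * R^o) : R :=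
  p.2 + \sum_i a i * p.1 0 i.

Lemma heightsum_linear a : linear (heightsum a : _ -> R^o).
Proof.
move=> c p q.
have -> : heightsum a (c *: p + q) =
    c * p.2 + q.2 + \sum_i a i * (c * p.1 0 i + q.1 0 i).
  by congr (_ + _); apply: eq_bigr => i _; rewrite !mxE.
transitivity (c * heightsum a p + heightsum a q : R) => //.
rewrite /heightsum mulrDr addrACA; congr (_ + _).
rewrite mulr_sumr -big_split /=; apply: eq_bigr => i _.
by rewrite mulrDr mulrCA.
Qed.

HB.instance Definition _ a :=
  GRing.isLinear.Build R ('rV[R]_n * R^o)%type R^o *%R (heightsum a)
    (heightsum_linear a).

Lemma heightsum_lifted a l :
  heightsum a (lifted l) = w l + \sum_(i in val l) a i.
Proof.
rewrite /heightsum /=; congr (_ + _); rewrite [RHS]big_mkcond /=.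
by apply: eq_bigr => i _; rewrite mxE; case: (i \in _); rewrite ?mulr1 ?mulr0.
Qed.

Lemma sum_delta (V : lmodType R) (v : evenset n -> V) l :
  \sum_m (m == l)%:R *: v m = v l.
Proof.
rewrite (bigD1 l) //= eqxx scale1r big1 ?addr0 // => m /negbTE ->.
by rewrite scale0r.
Qed.

Lemma lift_polytope_vertex l : lift_polytope w (lifted l).
Proof.
exists (fun m => (m == l)%:R); split; last by rewrite sum_delta.
  by move=> m; exact: ler0n.
have := sum_delta (fun=> 1 : R^o) l; rewrite /GRing.scale /= => {2}<-.
by apply: eq_bigr => m _; rewrite mulr1.
Qed.

Lemma scalar_conv (u : {scalar ('rV[R]_n * R^o)%type}) x q :
  (forall l, x <= u (lifted l)) -> lift_polytope w q -> x <= u q.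
Proof.
move=> xmin [c [c0 c1 ->]]; rewrite raddf_sum /= -[x]mul1r -c1 mulr_suml.
apply: ler_sum => l _; rewrite linearZ; exact: ler_wpM2l (c0 l) _ _ (xmin l).
Qed.

(** Each [e_l] is a vertex of the cube: a coordinate in which [m'] and [l] differ is extremal at
    [e_l] and forces the coefficient of [m'] to be 0. *)
Lemma lift_polytope_over_vertex p l :
  lift_polytope w p -> p.1 = evec R (val l) -> p = lifted l.
Proof.
move=> [c [c0 c1 pE]] p1.
have cl m : c m = (m == l)%:R.
  suff h m' : m' != l -> c m' = 0.
    have [->|/h //] := eqVneq m l.
    by rewrite -c1 (bigD1 l) //= big1 ?addr0.
  move=> m'l; have [i il] : exists i, (i \in val m') != (i \in val l).
    apply: contrapT => /forallNP h; move/eqP: m'l; apply; apply/val_inj/setP.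
    by move=> i; have /negP := h i; rewrite negbK => /eqP.
  have ci : (i \in val l)%:R = \sum_m c m * (i \in val m)%:R :> R.
    have -> : (i \in val l)%:R = p.1 0 i by rewrite p1 mxE.
    rewrite pE raddf_sum summxE; apply: eq_bigr => j _.
    by rewrite !mxE.
  have [iNm|im] := boolP (i \in val m'); move: il.
    rewrite iNm; case: (boolP (i \in val l)) ci => // _ /esym/eqP.
    rewrite psumr_eq0; last by move=> j _; rewrite mulr_ge0 ?ler0n.
    by move=> /allP /(_ m' (mem_index_enum _)) /=; rewrite iNm mulr1 => /eqP.
  rewrite (negbTE im); case: (boolP (i \in val l)) ci => // _ /esym/eqP.
  rewrite -[X in _ == X]c1 -subr_eq0 -sumrB -oppr_eq0 -sumrN psumr_eq0; last first.
    move=> j _; rewrite opprB subr_ge0.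
    by case: (_ \in _); rewrite ?mulr1 ?mulr0.
  move=> /allP /(_ m' (mem_index_enum _)) /=.
  by rewrite (negbTE im) mulr0 sub0r opprK => /eqP.
rewrite pE -(sum_delta lifted); apply: eq_bigr => m _.
by rewrite cl.
Qed.

(** A cell is a projection, so [e_l] in it only yields some point of the face above [e_l]; by
    [lift_polytope_over_vertex] that point is [lifted l]. *)
Lemma bases_of_cellP (u : {scalar ('rV[R]_n * R^o)%type}) l :
  reflect (forall m, u (lifted l) <= u (lifted m))
    (l \in bases_of (fst @` face_of u (lift_polytope w))%classic).
Proof.
rewrite inE; apply: (iffP (asboolP _)) => [[p [Pp pmin] p1] m|lmin].
  rewrite -(lift_polytope_over_vertex Pp p1); apply: pmin.
  exact: lift_polytope_vertex.
exists (lifted l) => //; split=> [|q]; first exact: lift_polytope_vertex.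
exact: scalar_conv.
Qed.

(* The factor only has to dominate all differences [w l - w m]. *)
Definition vertex_weight (l : evenset n) (i : 'I_n) : R :=
  (\sum_m `|w m|) *+ 2 * (-1) ^+ (i \in val l).

(** With [S] the sum of the absolute heights, every index in which [m] and [l] differ costs [2 S],
    while the heights differ by at most [2 S]. *)
Lemma vertex_weight_min l m :
  w l + \sum_(i in val l) vertex_weight l i <=
  w m + \sum_(i in val m) vertex_weight l i.
Proof.
have [->//|ml] := eqVneq m l.
have wle j : `|w j| <= \sum_m `|w m| by rewrite (bigD1 j) //= lerDl sumr_ge0.
set S := \sum_m `|w m| in wle; have S0 : 0 <= S by rewrite sumr_ge0.
have dif i : (i \in val l)%:R * vertex_weight l i <=
    (i \in val m)%:R * vertex_weight l i - ((i \in val l) (+) (i \in val m))%:R * (S *+ 2).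
  rewrite /vertex_weight -/S; move: (i \in val l) (i \in val m) => [] [] /=;
  rewrite ?expr0 ?expr1; nra.
have [i0 i0P] : exists i, (i \in val l) (+) (i \in val m).
  apply: contrapT => /forallNP h; move/eqP: ml; apply; apply/val_inj/setP.
  by move=> i; have /negP := h i; rewrite negb_add eq_sym => /eqP.
have sumE (p : evenset n) : \sum_(i in val p) vertex_weight l i =
    \sum_i (i \in val p)%:R * vertex_weight l i.
  rewrite big_mkcond; apply: eq_bigr => i _ /=.
  by case: ifP; rewrite ?mul1r ?mul0r.
have : \sum_(i in val l) vertex_weight l i <= \sum_(i in val m) vertex_weight l i - S *+ 2.
  rewrite !sumE; apply: (le_trans (ler_sum _ (fun i _ => dif i))).
  rewrite sumrB lerD2l lerN2 (bigD1 i0) //= i0P mul1r lerDl sumr_ge0 // => i _.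
  by rewrite mulr_ge0 ?ler0n ?mulrn_wge0.
have := wle l; have := wle m; rewrite !ler_norml => /andP [A _] /andP [_ B]; lra.
Qed.

(** Move the functional linearly from [vertex_weight l] to [vertex_weight m]. The height of each
    vertex is affine in time, and vertices minimal at the same time share a cell, so
    [lower_envelope_ind] applies. *)
Lemma cells_connected (P : evenset n -> Prop) :
  (forall (Q : cell w) l m, l \in bases_of (sval Q) -> m \in bases_of (sval Q) ->
     P l -> P m) ->
  forall l m, P l -> P m.
Proof.
move=> step l m.
pose d := fun i => vertex_weight m i - vertex_weight l i.
have dE (p : evenset n) : \sum_(i in val p) vertex_weight l i +
    \sum_(i in val p) d i = \sum_(i in val p) vertex_weight m i.
  by rewrite -big_split; apply: eq_bigr => i _; rewrite /d /= addrC subrK.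
apply: (@lower_envelope_ind R _ (fun j => w j + \sum_(i in val j) vertex_weight l i)
  (fun j => \sum_(i in val j) d i)) => [t p q pmin qmin| |j]; first last.
- by rewrite -!addrA !dE; exact: vertex_weight_min.
- exact: vertex_weight_min.
pose a i := vertex_weight l i + t * d i.
have aE j : heightsum a (lifted j) =
    w j + \sum_(i in val j) vertex_weight l i + t * \sum_(i in val j) d i.
  by rewrite heightsum_lifted mulr_sumr -addrA -big_split.
have u1 : 0 < heightsum a (0, 1).
  by rewrite /heightsum /= big1 ?addr0 // => i _; rewrite mxE mulr0.
pose Q : cell w := exist _ _ (ex_intro2 _ _ (heightsum a : {scalar _}) u1 erefl).
by apply: (step Q); apply/bases_of_cellP => j /=; rewrite !aE.
Qed.

End Cells.

(** * Restriction of polynomials to sets of monomials *)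

Section MonomialRestriction.
Variables (k : fieldType) (N : nat).
Implicit Types (f : {mpoly k[N]}) (m : 'X_{1..N}) (P : pred 'X_{1..N}).

(** Common form of initial forms, graded components and restrictions to the variables of a cell;
    [init_form] is convertible to an instance. *)
Definition mrestr P f : {mpoly k[N]} :=
  \sum_(m <- msupp f | P m) f@_m *: 'X_[m].

Lemma mcoeff_mrestr P f m : (mrestr P f)@_m = if P m then f@_m else 0.
Proof.
rewrite /mrestr raddf_sum /= big_mkcond /=.
have [mf|mNf] := boolP (m \in msupp f).
  rewrite (bigD1_seq m) ?msupp_uniq //= mcoeffZ mcoeffX eqxx mulr1 big1 ?addr0 //.
  by move=> m' /negbTE m'm; rewrite mcoeffZ mcoeffX m'm mulr0 if_same.
rewrite (memN_msupp_eq0 mNf) if_same big1_seq // => m' /andP [_ m'f].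
rewrite mcoeffZ mcoeffX; case: eqP m'f => [->|_ _]; first by rewrite (negbTE mNf).
by rewrite mulr0 if_same.
Qed.

Lemma mem_msupp_mrestr P f m :
  (m \in msupp (mrestr P f)) = P m && (m \in msupp f).
Proof. by rewrite !mcoeff_msupp mcoeff_mrestr; case: (P m); rewrite ?eqxx. Qed.

Lemma mrestr_mrestr P P' f : mrestr P (mrestr P' f) = mrestr (predI P P') f.
Proof. by apply/mpolyP => m; rewrite !mcoeff_mrestr /=; case: (P m). Qed.

Lemma eq_mrestr P P' f : {in msupp f, P =1 P'} -> mrestr P f = mrestr P' f.
Proof.
move=> PP'; apply/mpolyP => m; rewrite !mcoeff_mrestr.
have [/PP' -> //|/memN_msupp_eq0 ->] := boolP (m \in msupp f).
by rewrite !if_same.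
Qed.

Lemma meval_mrestr P f (z : 'I_N -> k) :
  (mrestr P f).@[z] = \sum_(m <- msupp f | P m) f@_m * \prod_j z j ^+ m j.
Proof.
rewrite /mrestr raddf_sum; apply: eq_bigr => m _ /=.
by rewrite mevalZ mevalX.
Qed.

Definition vweight (c : 'I_N -> nat) m : nat := (\sum_j c j * m j)%N.

Lemma prod_scale_exp (s : k) c (z : 'I_N -> k) m :
  \prod_j (s ^+ c j * z j) ^+ m j = s ^+ vweight c m * \prod_j z j ^+ m j.
Proof.
rewrite /vweight -prodrXr -big_split /=; apply: eq_bigr => j _.
by rewrite exprMn exprM.
Qed.

(** In characteristic 0 the images of [0, ..., size p - 1] are distinct, which is one root more than
    a nonzero [p] can have. *)
Lemma poly_eq0_char0 (p : {poly k}) :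
  [pchar k] =i pred0 -> (forall s, p.[s] = 0) -> p = 0.
Proof.
move=> /pcharf0P k0 p0; apply/eqP; apply: contraT => pn0.
have inj : injective (fun i : nat => i%:R : k).
  suff h i j : i%:R = j%:R :> k -> (i <= j)%N.
    by move=> i j ij; apply/eqP; rewrite eqn_leq !h.
  move=> ij; rewrite leqNgt; apply/negP => ji.
  have : (i - j)%:R == 0 :> k by rewrite natrB ?ij ?subrr // ltnW.
  by rewrite k0 subn_eq0 leqNgt ji.
have := @max_poly_roots _ p [seq i%:R | i <- iota 0 (size p)] pn0.
rewrite map_inj_uniq ?iota_uniq // size_map size_iota ltnn => -> //.
by apply/allP => _ /mapP [i _ ->]; rewrite /root p0.
Qed.

(* [f] evaluated at the point scaled by [s] is a polynomial in [s] whose     *)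
(* coefficients are the values of the weighted components of [f].            *)
Lemma meval_vweight_component (c : 'I_N -> nat) f (z : 'I_N -> k) a :
  [pchar k] =i pred0 -> (forall s, f.@[fun j => s ^+ c j * z j] = 0) ->
  (mrestr (fun m => vweight c m == a) f).@[z] = 0.
Proof.
move=> k0 fz.
pose p : {poly k} :=
  \sum_(m <- msupp f) (f@_m * \prod_j z j ^+ m j) *: 'X^(vweight c m).
have p0 : p = 0.
  apply: poly_eq0_char0 => // s; rewrite -[RHS](fz s) mevalE horner_sum.
  apply: eq_bigr => m _; rewrite hornerZ hornerXn prod_scale_exp.
  by rewrite -mulrA [_ * s ^+ _]mulrC.
have := congr1 (fun q : {poly k} => q`_a) p0.
rewrite coef0 coef_sum meval_mrestr => {2}<-; rewrite big_mkcond /=.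
apply: eq_bigr => m _; rewrite coefZ coefXn eq_sym.
by case: ifP => _; rewrite ?mulr1 ?mulr0.
Qed.

Lemma meval_dhomog_scale d f (s : k) (z : 'I_N -> k) :
  f \is d.-homog -> f.@[fun j => s * z j] = s ^+ d * f.@[z].
Proof.
move=> /dhomogP fd; rewrite !mevalE big_distrr /= !big_seq; apply: eq_bigr => m mf.
have := prod_scale_exp s (fun=> 1%N) z m.
rewrite (eq_bigr (fun j => (s * z j) ^+ m j)) => [->|j _]; last by rewrite expr1.
rewrite mulrCA; congr (_ ^+ _ * _); rewrite -(fd m mf) /= mdegE.
by apply: eq_bigr => j _; rewrite mul1n.
Qed.

End MonomialRestriction.

Lemma ideal_gen_ind (A : comNzRingType) (S T : set A) :
  is_ideal T -> (forall a, S a -> T a) -> forall a, ideal_gen S a -> T a.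
Proof. by move=> iT ST a; apply. Qed.

Lemma ideal_gen_sub (A : comNzRingType) (S : set A) a : S a -> ideal_gen S a.
Proof. by move=> Sa T [_]; apply. Qed.

(** * Pfaffians under diagonal congruence *)

Section Pfaffian.
Variable k : fieldType.

Lemma odd_ordS m (i : 'I_m) : ~~ odd m -> odd (ordS i) = ~~ odd i.
Proof.
move=> em; have /= := ltn_ord i; rewrite leq_eqVlt => /orP [/eqP iE|lt].
  have : ~~ odd i.+1 by rewrite iE.
  by rewrite /= iE modnn => /negbNE ->.
by rewrite /= modn_small.
Qed.

(** In the term of [s] the pairs [s i], [s (ordS i)] with [i] even partition the indices, so each
    [e] occurs exactly once. *)
Lemma pfaffian_congr m (e : 'I_m -> k) (A : 'M[k]_m) :
  pfaffian (\matrix_(i, j) (e i * e j * A i j)) = (\prod_i e i) * pfaffian A.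
Proof.
rewrite /pfaffian; case: ifP => [_|/negbT em]; first by rewrite mulr0.
rewrite mulrCA; congr (_ * _); rewrite big_distrr; apply: eq_bigr => s _ /=.
rewrite [RHS]mulrCA; congr (_ * _).
rewrite (eq_bigr (fun i => (e (s i) * e (s (ordS i))) * A (s i) (s (ordS i)))); last first.
  by move=> i _; rewrite mxE.
suff -> : \prod_i e i =
    \prod_(i < m | ~~ odd i) (e (s i) * e (s (ordS i))) by rewrite big_split.
rewrite big_split /=.
rewrite (reindex_inj (@perm_inj _ s)) (bigID (fun i : 'I_m => ~~ odd i)) /=.
congr (_ * _); rewrite (reindex_inj (@ordS_inj m)).
by apply: eq_bigl => i; rewrite odd_ordS // negbK.
Qed.

Lemma pfaffian0 m (A : 'M[k]_m) : m = 0%N -> pfaffian A = 1.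
Proof.
move=> m0; subst m; rewrite /pfaffian /= fact0 expn0 muln1 invr1 mul1r.
rewrite (eq_bigr (fun=> 1)) => [|s _]; last first.
  by rewrite big_ord0 mulr1 (_ : s = 1%g) ?odd_perm1 //; apply/permP => -[].
by rewrite sumr_const card_Sn.
Qed.

End Pfaffian.

(** * The multigrading of the spinor ideal *)

Section SpinorIdeal.
Variables (k : fieldType) (n : nat).
Hypothesis k0 : [pchar k] =i pred0.
Local Notation N := #|{: evenset n}|.
Implicit Types (f : {mpoly k[N]}).

(** The scalar 0 is allowed, so that the set is stable under scaling by every [s] in [k], as
    [meval_vweight_component] requires. *)
Definition spinor_cone (z : evenset n -> k) : Prop :=
  exists s (X : 'M[k]_n), X^T = - X /\ z = fun l => s * pfaffian_pt X l.

Lemma evenset_full : ~~ odd (n - #|[set: 'I_n]%SET|).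
Proof. by rewrite cardsT card_ord subnn. Qed.

(** Its coordinate is the Pfaffian of the empty matrix, hence 1 at every [pfaffian_pt]. It later
    serves as the reference coordinate for ratios. *)
Definition full_evenset : evenset n := exist _ [set: 'I_n]%SET evenset_full.

Lemma pfaffian_pt_spinor (X : 'M[k]_n) :
  X^T = - X -> @spinor_variety k n (pfaffian_pt X).
Proof.
move=> skX; split=> [|d f _ fz]; last by apply: fz; exists X.
exists full_evenset.
by rewrite /pfaffian_pt pfaffian0 ?oner_eq0 //= finset.setCT cards0.
Qed.

Lemma spinor_ideal_cone f z : spinor_ideal f -> spinor_cone z ->
  f.@[fun j => z (enum_val j)] = 0.
Proof.
move=> If [s [X [skX ->]]]; move: f If; apply: ideal_gen_ind.
  split=> [|a b a0 b0|a b b0]; first exact: meval0.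
    by rewrite mevalD a0 b0 addr0.
  by rewrite mevalM b0 mulr0.
move=> f [[d fd] fY]; rewrite (meval_dhomog_scale _ _ fd).
by rewrite (fY _ (pfaffian_pt_spinor skX)) mulr0.
Qed.

(** A homogeneous polynomial vanishing on the Pfaffian points vanishes on their closure by
    definition of the latter. *)
Lemma cone_spinor_ideal f d : f \is d.-homog ->
  (forall z, spinor_cone z -> f.@[fun j => z (enum_val j)] = 0) ->
  spinor_ideal f.
Proof.
move=> fd f0; apply: ideal_gen_sub; split; first by exists d.
move=> y [_]; apply; [exact: fd|] => _ [X skX <-]; apply: f0.
by exists 1, X; split=> //; apply/funext => l; rewrite mul1r.
Qed.

(* The gradings by total degree and, for [i : 'I_n], by the degree in the    *)
(* variables [q_l] with [i \notin l], on whose values at [X] the scaling of  *)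
(* row and column [i] of [X] acts.                                           *)
Definition torus_weight (o : option 'I_n) (l : evenset n) : nat :=
  if o is Some i then (i \notin val l : nat) else 1%N.

Lemma spinor_cone_scale o (s : k) z :
  spinor_cone z -> spinor_cone (fun l => s ^+ torus_weight o l * z l).
Proof.
move=> [t [X [skX ->]]]; case: o => [i|] /=; last first.
  by exists (s * t), X; split=> //; apply/funext => l; rewrite expr1 mulrA.
(* The new matrix is [D X D] with [D] diagonal, with entry [s] at [i] and 1 elsewhere. *)
pose e (j : 'I_n) := s ^+ (j == i).
exists t, (\matrix_(a, b) (e a * e b * X a b)); split.
  apply/matrixP => a b; rewrite !mxE [e b * _]mulrC -mulrN; congr (_ * _).
  by have := congr1 (fun M : 'M_n => M a b) skX; rewrite !mxE.
apply/funext => l; rewrite mulrCA; congr (_ * _); rewrite /pfaffian_pt.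
set mu := (~: val l)%SET.
have -> : principal_submx (\matrix_(a, b) (e a * e b * X a b)) mu =
    \matrix_(a, b) (e (enum_val a) * e (enum_val b) * principal_submx X mu a b).
  by apply/matrixP => a b; rewrite /principal_submx !mxE.
rewrite pfaffian_congr; congr (_ * _).
rewrite -(big_enum_val e) /= prodrXr; congr (_ ^+ _).
have -> : (i \notin val l) = (i \in mu) by rewrite inE.
rewrite big_mkcond (bigD1 i) //= eqxx big1 ?addn0; first by case: (i \in mu).
by move=> j /negbTE ->; rewrite if_same.
Qed.

(** It determines the sum of the vectors [e_l] over a monomial: coordinate [i] is the value at
    [None] minus the value at [Some i]. *)
Definition multidegree (m : 'X_{1..N}) : {ffun option 'I_n -> nat} :=
  [ffun o => vweight (fun j => torus_weight o (enum_val j)) m].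

Lemma spinor_ideal_component f al : spinor_ideal f ->
  spinor_ideal (mrestr (fun m => multidegree m == al) f).
Proof.
move=> If; apply: (@cone_spinor_ideal _ (al None)).
  apply/dhomogP => m; rewrite mem_msupp_mrestr => /andP [/eqP <- _].
  by rewrite ffunE /= mdegE; apply: eq_bigr => j _; rewrite mul1n.
pose P o (m : 'X_{1..N}) := vweight (fun j : 'I_N => torus_weight o (enum_val j)) m == al o.
(* The gradings are imposed one at a time; each preserves vanishing on the cone because the cone is
   stable under the corresponding scaling. *)
have h (s : seq (option 'I_n)) z : spinor_cone z ->
    (mrestr (fun m => all (P^~ m) s) f).@[fun j => z (enum_val j)] = 0.
  elim: s z => [|o s IHs] z Cz /=.
    rewrite (_ : mrestr _ f = f); first exact: spinor_ideal_cone.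
    by apply/mpolyP => m; rewrite mcoeff_mrestr.
  rewrite -(mrestr_mrestr (P o)); apply: meval_vweight_component => // t.
  exact: IHs (spinor_cone_scale o t Cz).
move=> z Cz; rewrite -[RHS](h (enum {: option 'I_n}) z Cz); congr (meval _ _).
apply: eq_mrestr => m _; apply/eqP/allP => [mal o _|Pm]; first by rewrite /P -mal ffunE.
by apply/ffunP => o; rewrite ffunE; apply/eqP/Pm; rewrite mem_enum.
Qed.

End SpinorIdeal.

(** * Evaluation at points with values in an algebra *)

Section PolynomialEvaluation.
Variables (k : fieldType) (I : finType) (A : comAlgType k).
Implicit Types (x : I -> A) (f : {mpoly k[#|I|]}).

Lemma pevalD x f g : peval x (f + g) = peval x f + peval x g.
Proof. exact: raddfD. Qed.

Lemma pevalM x f g : peval x (f * g) = peval x f * peval x g.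
Proof. exact: rmorphM. Qed.

Lemma peval_sum x (T : Type) (s : seq T) (F : T -> {mpoly k[#|I|]}) :
  peval x (\sum_(i <- s) F i) = \sum_(i <- s) peval x (F i).
Proof. exact: raddf_sum. Qed.

Lemma peval_qvar x i : peval x (qvar k i) = x i.
Proof. by rewrite /peval mmapX mmap1U enum_rankK. Qed.

Lemma peval_mrestr x P f : peval x (mrestr P f) =
  \sum_(m <- msupp f | P m) f@_m *: \prod_j x (enum_val j) ^+ m j.
Proof.
rewrite /peval /mrestr raddf_sum; apply: eq_bigr => m _ /=.
by rewrite mmapZ mmapX /= mulr_algl.
Qed.

Lemma peval_dhomog_scale d f (u : A) x : f \is d.-homog ->
  peval (fun i => u * x i) f = u ^+ d * peval x f.
Proof.
move=> /dhomogP fd; rewrite /peval /mmap big_distrr /= !big_seq.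
apply: eq_bigr => m mf; rewrite mulrCA; congr (_ * _).
rewrite -(fd m mf) /= mdegE -prodrXr -big_split; apply: eq_bigr => j _ /=.
by rewrite exprMn.
Qed.

Lemma sum_enum_rank (V : nmodType) (F : I -> nat -> V) (m : 'X_{1..#|I|}) :
  \sum_i F i (m (enum_rank i)) = \sum_j F (enum_val j) (m j).
Proof.
rewrite (reindex (@enum_val I I)); last exact: onW_bij (enum_val_bij I).
by apply: eq_bigr => j _; rewrite enum_valK.
Qed.

End PolynomialEvaluation.

(** * The initial ideal and the equations of the strata *)

Section InitialIdeal.
Variables (k : fieldType) (R : realType) (n : nat) (w : evenset n -> R).
Hypothesis k0 : [pchar k] =i pred0.
Local Notation N := #|{: evenset n}|.
Local Notation component al := (mrestr (fun m => multidegree m == al)).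
Implicit Types (f h : {mpoly k[N]}) (P : pred 'X_{1..N}).

Definition wmin f : pred 'X_{1..N} :=
  fun m => all (fun m' => wdeg w m <= wdeg w m') (msupp f).

(** In each multidegree that [P] meets, [P] selects the initial form of the component; the other
    multidegrees contribute nothing. Applied to [wmin h] and to the monomials supported on a
    cell. *)
Lemma mrestr_init_components P h :
  (forall m0 m, m0 \in msupp h -> m \in msupp h -> P m0 ->
     multidegree m = multidegree m0 ->
     P m = wmin (component (multidegree m0) h) m) ->
  mrestr P h = \sum_(al <- undup [seq multidegree m | m <- msupp h & P m])
     init_form w (component al h).
Proof.
move=> Ph; apply/mpolyP => m; rewrite mcoeff_mrestr raddf_sum /=.
have [mh|mNh] := boolP (m \in msupp h); last first.
  rewrite (memN_msupp_eq0 mNh) if_same big1 // => al _.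
  by rewrite !mcoeff_mrestr (memN_msupp_eq0 mNh) !if_same.
set s := undup _.
have [ms|mNs] := boolP (multidegree m \in s); last first.
  rewrite big1_seq => [|al /andP [_ als]]; last first.
    rewrite !mcoeff_mrestr; case: eqP => [mal|]; last by rewrite if_same.
    by rewrite mal als in mNs.
  case: ifP => // Pm; move: mNs; rewrite mem_undup => /mapP []; exists m => //.
  by rewrite mem_filter Pm.
rewrite (bigD1_seq (multidegree m)) ?undup_uniq //= big1 ?addr0; last first.
  by move=> al /negbTE alm; rewrite !mcoeff_mrestr eq_sym alm if_same.
rewrite !mcoeff_mrestr eqxx.
move: ms; rewrite mem_undup => /mapP [m0]; rewrite mem_filter => /andP [Pm0 m0h] E.
by rewrite (Ph m0 m) // -E.
Qed.

Lemma component_init_ideal h al : spinor_ideal h ->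
  init_ideal w (@spinor_ideal k n) (init_form w (component al h)).
Proof.
move=> Ih; apply: ideal_gen_sub; exists (component al h) => //.
exact: spinor_ideal_component.
Qed.

Lemma component_init_dhomog h al : init_form w (component al h) \is (al None).-homog.
Proof.
apply/dhomogP => m; rewrite -[init_form _ _]/(mrestr (wmin _) _) !mem_msupp_mrestr.
case/and3P => _ /eqP <- _; rewrite ffunE /= mdegE.
by apply: eq_bigr => j _; rewrite mul1n.
Qed.

Section Point.
Variables (A : comAlgType k) (x : evenset n -> A).
Hypothesis x0 : forall f, init_ideal w (@spinor_ideal k n) f -> peval x f = 0.

(** The initial ideal is homogeneous, although its generators need not be: each is a sum of initial
    forms of components, which are homogeneous and lie in it. *)
Lemma init_ideal_scale (u : A) f : init_ideal w (@spinor_ideal k n) f ->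
  peval (fun l => u * x l) f = 0.
Proof.
move: f; apply: ideal_gen_ind => [|f [h Ih <-]].
  split=> [|a b a0 b0|a b b0]; first exact: raddf0.
    by rewrite pevalD a0 b0 addr0.
  by rewrite pevalM b0 mulr0.
rewrite -[init_form _ _]/(mrestr (wmin h) h) mrestr_init_components.
  rewrite peval_sum big1 // => al _.
  rewrite (peval_dhomog_scale _ _ (component_init_dhomog _ _)).
  by rewrite x0 ?mulr0 //; exact: component_init_ideal.
move=> m0 m m0h mh m0min E; apply/allP/allP => mmin m'.
  by rewrite mem_msupp_mrestr => /andP [_]; exact: mmin.
move=> m'h; apply: le_trans (allP m0min _ m'h); apply: mmin.
by rewrite mem_msupp_mrestr eqxx.
Qed.

Variable u : {scalar ('rV[R]_n * R^o)%type}.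
Hypothesis u_gt0 : 0 < u (0, 1).
Let B := bases_of (fst @` face_of u (lift_polytope w))%classic.
Let supported (m : 'X_{1..N}) := [forall j, (enum_val j \notin B) ==> (m j == 0%N)].

(** The [u]-weight splits into a part depending only on the sum of the [e_l], hence on the
    multidegree, and [u (0, 1)] times the [w]-weight. *)
Lemma lifted_weight m m' : multidegree m = multidegree m' ->
  \sum_j u (lifted w (enum_val j)) *+ m j - \sum_j u (lifted w (enum_val j)) *+ m' j
  = (wdeg w m - wdeg w m') * u (0, 1).
Proof.
move=> mm'.
pose V (p : 'X_{1..N}) : 'rV[R]_n := \sum_j evec R (val (enum_val j)) *+ p j.
have VE : V m = V m'.
  apply/rowP => i; rewrite !summxE.
  have vE (p : 'X_{1..N}) :
      \sum_j ((evec R (val (enum_val j)) *+ p j : 'rV[R]_n) 0 i) =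
      ((multidegree p None)%:R - (multidegree p (Some i))%:R).
    rewrite !ffunE /vweight !natr_sum -sumrB; apply: eq_bigr => j _.
    rewrite mulmxnE mxE /= mul1n; case: (_ \in _); rewrite ?mul0n ?mul1n ?subr0 //.
    by rewrite subrr mul0rn.
  by rewrite !vE mm'.
have uE (p : 'X_{1..N}) :
    \sum_j u (lifted w (enum_val j)) *+ p j = u (V p, 0) + wdeg w p * u (0, 1).
  have -> : wdeg w p * u (0, 1) = u (0, wdeg w p).
    rewrite (_ : (0, wdeg w p) = wdeg w p *: ((0, 1) : 'rV[R]_n * R^o)).
      by rewrite linearZ.
    by apply: injective_projections; rewrite /= ?scaler0 //; exact/esym/mulr1.
  rewrite -raddfD /=.
  under eq_bigr do rewrite -raddfMn.
  rewrite -raddf_sum; congr (u _).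
  rewrite /wdeg (sum_enum_rank (fun l d => w l *+ d)).
  apply: injective_projections => /=.
    rewrite addr0 raddf_sum; apply: eq_bigr => j _; exact: raddfMn.
  rewrite add0r raddf_sum; apply: eq_bigr => j _; exact: raddfMn.
by rewrite !uE VE opprD addrACA subrr add0r mulrBl.
Qed.

Lemma supported_wmin h m0 m : m0 \in msupp h -> m \in msupp h ->
  supported m0 -> multidegree m = multidegree m0 ->
  supported m = wmin (component (multidegree m0) h) m.
Proof.
move=> m0h mh m0B E.
pose v l := u (lifted w l).
case: (@Order.TotalTheory.arg_minP _ _ _ (full_evenset n) xpredT v isT) => lm _ lmin.
have BE l : (l \in B) = (v l == v lm).
  apply/bases_of_cellP/eqP => [lB|vl p]; last by rewrite -/(v l) vl; exact: lmin.
  by apply/le_anti/andP; split; [exact: lB|exact: lmin].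
(* The excess of the [u]-weight over its least value for the degree: never negative, zero exactly on
   supported monomials, and ordered like [wdeg w] within a multidegree. *)
pose ex (p : 'X_{1..N}) := \sum_j (v (enum_val j) - v lm) *+ p j.
have term_ge0 (p : 'X_{1..N}) j : 0 <= (v (enum_val j) - v lm) *+ p j.
  by rewrite mulrn_wge0 // subr_ge0 lmin.
have exE (p p' : 'X_{1..N}) : multidegree p = multidegree p' ->
    ex p - ex p' = (wdeg w p - wdeg w p') * u (0, 1).
  move=> pp'; rewrite -(lifted_weight pp').
  have exS (q : 'X_{1..N}) :
      ex q = \sum_j v (enum_val j) *+ q j - v lm *+ multidegree q None.
    rewrite ffunE /vweight -sumrMnr -sumrB; apply: eq_bigr => j _.
    by rewrite mul1n mulrnBl.
  by rewrite !exS pp' opprB addrA subrK.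
have exB (p : 'X_{1..N}) : supported p = (ex p == 0).
  rewrite psumr_eq0; last by move=> j _; exact: term_ge0.
  apply/forallP/allP => /= h0 j; last first.
    apply/implyP => jB; have := h0 j (mem_index_enum _).
    by rewrite mulrn_eq0 subr_eq0 -BE (negbTE jB) orbF.
  move=> _; have := h0 j; rewrite mulrn_eq0 subr_eq0 -BE.
  by case: (_ \in B); rewrite ?orbT //= orbF.
have ex_ge0 (p : 'X_{1..N}) : 0 <= ex p by apply: sumr_ge0 => j _.
have leE (p p' : 'X_{1..N}) : multidegree p = multidegree p' ->
    (wdeg w p <= wdeg w p') = (ex p <= ex p').
  by move=> pp'; rewrite -subr_le0 -[RHS]subr_le0 exE // pmulr_lle0.
rewrite exB; apply/eqP/allP => [m0E m'|mmin].
  rewrite mem_msupp_mrestr => /andP [/eqP E' _].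
  by rewrite leE ?m0E ?ex_ge0 // E' E.
apply/le_anti; rewrite ex_ge0 andbT; move: (m0B); rewrite exB => /eqP <-.
by rewrite -leE // mmin // mem_msupp_mrestr eqxx.
Qed.

Lemma peval_basis_incl (C : {set evenset n}) (z : evenset n -> A)
    (f : {mpoly k[#|{: basis_var C}|]}) :
  peval z (basis_incl f) = peval (z \o val) f.
Proof.
rewrite /basis_incl comp_mpolyE peval_sum; apply: eq_bigr => m _.
rewrite /peval mmapZ rmorph_prod; congr (_ * _); apply: eq_bigr => j _.
rewrite rmorphXn tnth_mktuple; congr (_ ^+ _); exact: peval_qvar.
Qed.

Lemma stratum_ideal_vanish (f : {mpoly k[#|{: basis_var B}|]}) :
  stratum_ideal f -> peval (x \o val) f = 0.
Proof.
move=> [g Ig [h Ih ghf]].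
(* Extending by 0 outside [B] kills the variables that generate the ideal containing [g]. *)
pose x' l := if l \in B then x l else 0.
have -> : x \o val = x' \o val :> (basis_var B -> A).
  by apply/funext => l; rewrite /x' /= (valP l).
rewrite -peval_basis_incl -ghf pevalD.
have -> : peval x' g = 0.
  move: g Ig {ghf}; apply: ideal_gen_ind => [|_ [l lB <-]]; last first.
    by rewrite peval_qvar /x' (negbTE lB).
  split=> [|a b a0 b0|a b b0]; first exact: raddf0.
    by rewrite pevalD a0 b0 addr0.
  by rewrite pevalM b0 mulr0.
rewrite add0r.
(* Monomials with a variable outside [B] vanish at [x']; the others have the same value at [x]. *)
have -> : peval x' h = peval x (mrestr supported h).
  have -> : h = mrestr xpredT h by apply/mpolyP => m; rewrite mcoeff_mrestr.
  rewrite mrestr_mrestr !peval_mrestr [RHS]big_mkcond.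
  apply: eq_bigr => m _ /=; rewrite andbT.
  case: ifPn => [/forallP mB|]; last first.
    rewrite negb_forall => /existsP [j]; rewrite negb_imply => /andP [jB mj].
    by rewrite (bigD1 j) //= /x' (negbTE jB) expr0n (negbTE mj) mul0r scaler0.
  congr (_ *: _); apply: eq_bigr => j _; rewrite /x'; case: ifPn => // jB.
  by have /implyP /(_ jB) /eqP -> := mB j; rewrite !expr0.
rewrite mrestr_init_components; last exact: supported_wmin.
by rewrite peval_sum big1 // => al _; exact: x0 (component_init_ideal _ Ih).
Qed.

End Point.
End InitialIdeal.

(** * Representatives of torus points *)

Section TorusPoints.
Variables (I J : finType) (A : comNzRingType).
Local Open Scope classical_set_scope.

Lemma unit_class_eq (x z : I -> A) : unit_class x z -> unit_class z = unit_class x.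
Proof.
move=> [u [v uv] ->]; apply/seteqP; split=> y [a ua ->].
  exists (a * u); first by apply: is_unitM => //; exists v.
  by apply/funext => i; rewrite mulrA.
exists (a * v); first by apply: is_unitM => //; exists u; rewrite mulrC.
by apply/funext => i; rewrite mulrA -(mulrA a) (mulrC v) uv mulr1.
Qed.

Lemma coords_eq (p : torus_pt I A) x : coords p x -> coords p = unit_class x.
Proof. by have [y _ ->] := coordsP p => /unit_class_eq ->. Qed.

Lemma coords_restr (g : J -> I) (p : torus_pt I A) x :
  coords p x -> coords (torus_restr g p) (x \o g).
Proof. by move=> px; exists x. Qed.

Lemma torus_pt_coords (p q : torus_pt I A) x : coords p x -> coords q x -> p = q.
Proof. by move=> /coords_eq px /coords_eq qx; apply: torus_pt_eq; rewrite px. Qed.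

End TorusPoints.

Lemma coords_push (I : finType) (A B : comNzRingType) (f : {rmorphism A -> B})
    (p : torus_pt I A) x :
  coords p x -> coords (torus_push f p) (f \o x).
Proof. by move=> px; exists x => //; exact: unit_class_id. Qed.

(** * The closed immersion *)

Section Immersion.
Variables (k : fieldType) (R : realType) (n : nat) (w : evenset n -> R).
Hypothesis k0 : [pchar k] =i pred0.

Lemma init_degen_restr_proof (A : comAlgType k) (p : init_degen k w A)
    (Q : cell w) :
  exists2 y, coords (torus_restr (val : basis_var (bases_of (sval Q)) -> _) (sval p)) y &
    forall f, @stratum_ideal k n (bases_of (sval Q)) f -> peval y f = 0.
Proof.
case: p => p [x px x0] /=; exists (x \o val); first exact: coords_restr.
by case: Q => S [u u1 SE] /= f; subst S; exact: stratum_ideal_vanish.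
Qed.

Definition init_degen_restr (A : comAlgType k) (p : init_degen k w A)
    (Q : cell w) : stratum k (bases_of (sval Q)) A :=
  exist _ _ (init_degen_restr_proof p Q).

Lemma init_degen_restr_compat (A : comAlgType k) (p : init_degen k w A)
    (Q Q' : cell w) (h : is_face (sval Q') (sval Q)) :
  torus_restr (basis_var_incl (bases_of_face h)) (sval (init_degen_restr p Q))
  = sval (init_degen_restr p Q').
Proof.
case: p => p [x px x0] /=.
have := coords_restr (basis_var_incl (bases_of_face h)) (coords_restr val px).
by move/torus_pt_coords; apply; exact: coords_restr.
Qed.

Definition init_degen_lim (A : comAlgType k) (p : init_degen k w A) :
    lim_strata k w A :=
  exist _ (init_degen_restr p) (init_degen_restr_compat p).

Lemma init_degen_lim_nat (A B : comAlgType k) (phi : {lrmorphism A -> B})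
    (p : init_degen k w A) :
  init_degen_lim (Defs.pmap phi p) = Defs.pmap phi (init_degen_lim p).
Proof.
apply: sval_eq; apply: functional_extensionality_dep => Q; apply: sval_eq => /=.
exact: torus_restr_push.
Qed.

Definition init_degen_immersion : kmorphism (init_degen k w) (lim_strata k w) :=
  KMorphism init_degen_lim_nat.

(** Only the restrictions of [z] to the cells are constrained; the equations of the initial ideal
    are not imposed. *)
Definition over (A B : comAlgType k) (phi : {lrmorphism A -> B})
    (y : lim_strata k w A) (z : evenset n -> B) : Prop :=
  forall Q : cell w, coords (torus_push phi (sval (sval y Q))) (z \o val).

(* Along a path of cells from [full_evenset n] to [l] the point [y]          *)
(* prescribes the ratio of the two coordinates.  No coherence between        *)
(* different paths is claimed: [x] need not lie over [y].                    *)
Lemma over_determined (A : comAlgType k) (y : lim_strata k w A) :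
  exists2 x : evenset n -> A, (forall l, is_unit (x l)) &
    forall (B : comAlgType k) (phi : {lrmorphism A -> B}) z, over phi y z ->
      forall l, z l = z (full_evenset n) * phi (x l).
Proof.
pose P l := exists a : A, is_unit a /\
  forall (B : comAlgType k) (phi : {lrmorphism A -> B}) z, over phi y z ->
    z l = z (full_evenset n) * phi a.
suff hP l : P l.
  exists (fun l => sval (cid (hP l))) => [l|B phi z yz l].
    by case: cid => a [].
  by case: cid => a [_ aP] /=; exact: aP.
apply: (@cells_connected R n w P _ (full_evenset n)); last first.
  exists 1; split=> [|B phi z _]; first exact: is_unit1.
  by rewrite rmorph1 mulr1.
move=> Q l1 m lQ mQ [a [ua aP]].
pose l' : basis_var (bases_of (sval Q)) := exist _ l1 lQ.
pose m' : basis_var (bases_of (sval Q)) := exist _ m mQ.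
have [yQ uy yE] := coordsP (sval (sval y Q)).
have yc : coords (sval (sval y Q)) yQ by rewrite yE; exact: unit_class_id.
have [b yb] := uy l'.
(* Since [b] inverts [yQ l'], the ratio at [l1] is multiplied by the ratio of [m] to [l1] read off
   in the cell [Q]. *)
exists (a * (yQ m' * b)); split.
  apply: is_unitM => //; apply: is_unitM => //; exists (yQ l').
  by rewrite mulrC.
move=> B phi z yz; have := yz Q; rewrite (coords_eq (coords_push phi yc)).
move=> [v _ zE].
have zl : z l1 = v * phi (yQ l') := congr1 (fun g => g l') zE.
have zm : z m = v * phi (yQ m') := congr1 (fun g => g m') zE.
rewrite !rmorphM mulrA -aP // zl zm.
have pb : phi (yQ l') * phi b = 1 by rewrite -rmorphM yb rmorph1.
by rewrite -!mulrA; congr (_ * _); rewrite mulrCA pb mulr1.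
Qed.

Lemma init_degen_over (A B : comAlgType k) (phi : {lrmorphism A -> B})
    (y : lim_strata k w A) (p : init_degen k w B) z :
  init_degen_lim p = Defs.pmap phi y -> coords (sval p) z -> over phi y z.
Proof.
move=> py pz Q.
rewrite -[torus_push _ _]/(sval (sval (Defs.pmap phi y : lim_points w B) Q)) -py.
exact: coords_restr.
Qed.

Lemma init_degen_immersion_closed : closed_immersion init_degen_immersion.
Proof.
(* Dividing a representative by its coordinate at [full_evenset] turns it into [phi \o x]. *)
have coordsE (A B : comAlgType k) (phi : {lrmorphism A -> B}) y x
    (p : init_degen k w B) :
    (forall z, over phi y z -> forall l, z l = z (full_evenset n) * phi (x l)) ->
    init_degen_lim p = Defs.pmap phi y -> coords (sval p) (phi \o x).
  move=> xP py; have [z uz pE] := coordsP (sval p).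
  have pz : coords (sval p) z by rewrite pE; exact: unit_class_id.
  have [v zv] := uz (full_evenset n).
  rewrite pE; exists v; first by exists (z (full_evenset n)); rewrite mulrC.
  apply/funext => l /=; rewrite (xP _ (init_degen_over py pz) l) mulrA.
  by rewrite (mulrC v) zv mul1r.
split=> [A p q pq|A y].
  have [x _ xP] := over_determined (init_degen_lim p).
  have idE (q' : lim_strata k w A) : Defs.pmap (idfun : {lrmorphism A -> A}) q' = q'.
    exact: Defs.pmap_id.
  apply: sval_eq; apply: (@torus_pt_coords _ _ _ _ (idfun \o x)).
    by apply: (coordsE _ _ _ _ _ _ (xP _ _)); rewrite idE.
  by apply: (coordsE _ _ _ _ _ _ (xP _ _)); rewrite idE.
have [x ux xP] := over_determined y.
(* All elements killed by every [phi] along which [y] lifts. One implication is then immediate; for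
   the other, [J] must be shown to contain enough equations. *)
pose J (a : A) := forall (B : comAlgType k) (phi : {lrmorphism A -> B}),
  (exists p : init_degen k w B, init_degen_lim p = Defs.pmap phi y) -> phi a = 0.
exists J.
  split=> [B phi _|a b Ja Jb B phi h|a b Jb B phi h]; first exact: rmorph0.
    by rewrite rmorphD /= (Ja B phi h) (Jb B phi h) addr0.
  by rewrite rmorphM /= (Jb B phi h) mulr0.
move=> B phi; split=> [h a Ja|phiJ]; first exact: Ja.
have Jinit f : init_ideal w (@spinor_ideal k n) f -> J (peval x f).
  move=> If C psi [p py]; rewrite -peval_push.
  have := coordsE _ _ _ _ _ _ (xP _ _) py.
  have [z pz z0] := svalP p; rewrite (coords_eq pz) => -[c _ ->].
  exact: (init_ideal_scale k0 z0 c If).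
(* These 2 by 2 minors express that [x] and [yQ] are proportional on the cell. *)
have Jcell (Q : cell w) yQ (l m : basis_var (bases_of (sval Q))) :
    coords (sval (sval y Q)) yQ -> J (x (val l) * yQ m - x (val m) * yQ l).
  move=> yc C psi [p py].
  have := init_degen_over py (coordsE _ _ _ _ _ _ (xP _ _) py) Q.
  rewrite (coords_eq (coords_push psi yc)) => -[v _ zE].
  have E j : psi (x (val j)) = v * psi (yQ j) := congr1 (fun g => g j) zE.
  by rewrite rmorphB !rmorphM /= !E mulrAC -!mulrA [psi (yQ m) * _]mulrC subrr.
have pt : exists2 t, (forall l, is_unit (t l)) & unit_class (phi \o x) = unit_class t.
  by exists (phi \o x) => // l; exact: is_unit_rmorph.
pose t := TorusPt pt.
have tx : coords t (phi \o x) by exact: unit_class_id.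
have tP : exists2 z, coords t z &
    forall f, init_ideal w (@spinor_ideal k n) f -> peval z f = 0.
  by exists (phi \o x) => // f /Jinit Jf; rewrite peval_push phiJ.
exists (exist _ t tP : init_degen k w B).
apply: sval_eq; apply: functional_extensionality_dep => Q; apply: sval_eq => /=.
have [yQ uy yE] := coordsP (sval (sval y Q)).
have yc : coords (sval (sval y Q)) yQ by rewrite yE; exact: unit_class_id.
apply: (@torus_pt_coords _ _ _ _ (phi \o x \o val)); first exact: coords_restr.
rewrite (coords_eq (coords_push phi yc)).
(* A basis [l] supplies the scalar [x l / yQ l]; over an empty index set any two families agree. *)
have [l0|none] := pselect (exists l : basis_var (bases_of (sval Q)), True).
  have {l0} [l _] := l0; have [b yb] := uy l.
  exists (phi (x (val l) * b)).
    apply: is_unit_rmorph; apply: is_unitM => //; exists (yQ l).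
    by rewrite mulrC.
  apply/funext => m /=; rewrite -rmorphM.
  have := phiJ _ (Jcell Q yQ l m yc); rewrite rmorphB => /eqP.
  rewrite subr_eq0 => /eqP E; rewrite mulrAC rmorphM E -rmorphM.
  by rewrite -mulrA yb mulr1.
exists 1; first exact: is_unit1.
by apply/funext => m; case: none; exists m.
Qed.

End Immersion.

Theorem theorem1p1 (k : closedFieldType) (hk : [pchar k] =i pred0)
    (R : realType) (n : nat) (hn : (0 < n)%N)
    (w : evenset n -> R) (hw : @trop_spinor k R n w) :
  exists f : kmorphism (@init_degen k R n w) (@lim_strata k R n w),
    closed_immersion f.
Proof. by exists (init_degen_immersion w hk); exact: init_degen_immersion_closed. Qed.
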